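(* Let $(\Lambda,\mathcal{B},\mu)$ be a probability space such that for any $n\in\mathbb{N}$ there exists a partition of $\Lambda$ into $n$ disjoint measurable sets of equal measure. Let $N\in\mathbb{N}$ and let $\mathcal{A}=\{A_1,\dots,A_N\}$ be a family of measurable subsets of $\Lambda$ with $A_i\cap A_j=\emptyset$ for $i\ne j$, $\mu\left(\bigcup_{i=1}^NA_i\right)=1$ and $\mu(A_i)=\frac1N$ for $i=1,\dots,N$. Define $$K_{\mathcal{A}}(x,y)=\sum_{i=1}^N\frac{\mathbb{1}_{A_i}(x)\mathbb{1}_{A_i}(y)}{\mu(A_i)},\qquad x,y\in\Lambda.$$ Then the determinantal point process defined by the projection kernel $K_{\mathcal{A}}$ is equal (in law, as a process of unordered points) to the jittered sampling process associated with the partition $\mathcal{A}$.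
   Context: A point process sampling $N$ points on $\Lambda$ is given by exchangeable random points $X_1,\dots,X_N$ in $\Lambda$ with joint density $\rho^{(N)}$ with respect to $\mu^{\otimes N}$ (invariant under permutation of its arguments). Its reduced densities are $\rho^{(N)}_k(x_1,\dots,x_k)=\int_{\Lambda^{N-k}}\rho^{(N)}(x_1,\dots,x_N)\,d\mu(x_{k+1})\cdots d\mu(x_N)$. It is called determinantal with kernel $K$ (with respect to $\mu$) if it is simple (the probability of sampling a point more than once is zero) and $\rho^{(N)}_k(x_1,\dots,x_k)=\frac{(N-k)!}{N!}\det\left(K(x_i,x_j)\right)_{i,j=1}^k$ for $1\le k\le N$. The kernel $K_{\mathcal{A}}$ is the kernel of the orthogonal projection in $L^2(\Lambda,\mu)$ onto the ($N$-dimensional) space of functions spanned by $\mathbb{1}_{A_1},\dots,\mathbb{1}_{A_N}$. The jittered sampling process associated with $\mathcal{A}$ consists of $N$ independent random points, one in each $A_i$, the point in $A_i$ being distributed according to the probability measure $\mu_i(A)=N\mu(A_i\cap A)$. It is viewed as a process of unordered points (equivalently, the $N$ points are put into uniformly random order to obtain an exchangeable $N$-tuple). *)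

(* Defs.v *)
From HB Require Import structures.
From mathcomp Require Import all_boot all_order all_algebra all_fingroup.
From mathcomp Require Import all_classical all_reals all_analysis.

Set Implicit Arguments.
Unset Strict Implicit.
Unset Printing Implicit Defensive.
Import Order.TTheory GRing.Theory Num.Theory.

Local Open Scope classical_set_scope.
Local Open Scope ring_scope.

Section product_power.
Context d (T : measurableType d) (R : realType).

Definition cons_pair n (z : T * n.-tuple T) : n.+1.-tuple T :=
  [tuple of z.1 :: z.2].

Lemma measurable_cons_pair n : measurable_fun setT (@cons_pair n).
Proof.
apply: (@measurable_cons _ _ _ _ fst n snd).
  exact: measurable_fst.
exact: measurable_snd.
Qed.

HB.instance Definition _ n :=
  isMeasurableFun.Build _ _ _ _ (@cons_pair n) (@measurable_cons_pair n).

(* The product measure on n-tuples, with the sigma-algebra generated by the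
   coordinate projections. *)
Fixpoint mpower (mu : probability T R) n : probability (n.-tuple T) R :=
  match n with
  | 0 => dirac [tuple]
  | m.+1 => distribution (mu \x mpower mu m)%E (@cons_pair m)
  end.

End product_power.

Section point_processes.
Context d (T : measurableType d) (R : realType).

Definition permute n (s : 'S_n) (x : n.-tuple T) : n.-tuple T :=
  [tuple tnth x (s i) | i < n].

Definition joint d' (Om : measurableType d') (P : probability Om R) n
    (X : 'I_n -> {RV P >-> T}) (w : Om) : n.-tuple T :=
  [tuple X i w | i < n].

Definition exchangeable d' (Om : measurableType d') (P : probability Om R) n
    (X : 'I_n -> {RV P >-> T}) : Prop :=
  forall (s : 'S_n) (B : set (n.-tuple T)), measurable B ->
    P [set w | B (permute s (joint X w))] = P [set w | B (joint X w)].

Definition joint_density d' (Om : measurableType d') (P : probability Om R)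
    (mu : probability T R) n (X : 'I_n -> {RV P >-> T})
    (rho : n.-tuple T -> R) : Prop :=
  [/\ measurable_fun setT rho, (forall x, 0 <= rho x) &
    forall B : set (n.-tuple T), measurable B ->
      P [set w | B (joint X w)]
      = (\int[mpower mu n]_(x in B) (rho x)%:E)%E].

Definition point_process d' (Om : measurableType d') (P : probability Om R)
    (mu : probability T R) n (X : 'I_n -> {RV P >-> T})
    (rho : n.-tuple T -> R) : Prop :=
  [/\ exchangeable X, joint_density mu X rho &
    forall (s : 'S_n) (x : n.-tuple T), rho (permute s x) = rho x].

Definition reduced_density (mu : probability T R) n (rho : n.-tuple T -> R)
    k (lekn : (k <= n)%N) (x : k.-tuple T) : \bar R :=
  (\int[mpower mu (n - k)]_y
     (rho (tcast (subnKC lekn) [tuple of x ++ y]))%:E)%E.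

(* Negligibility rather than probability 0, as the diagonal of T * T need not
   be measurable. *)
Definition simple d' (Om : measurableType d') (P : probability Om R) n
    (X : 'I_n -> {RV P >-> T}) : Prop :=
  P.-negligible [set w | exists i j : 'I_n, i != j /\ X i w = X j w].

(* Densities are only determined up to null sets, hence the equality of reduced
   densities is an equality almost everywhere. *)
Definition determinantal d' (Om : measurableType d') (P : probability Om R)
    (mu : probability T R) n (K : T -> T -> R)
    (X : 'I_n -> {RV P >-> T}) : Prop :=
  simple X /\
  exists2 rho : n.-tuple T -> R, point_process mu X rho &
    forall k (lekn : (k <= n)%N), (0 < k)%N ->
      {ae mpower mu k, forall x : k.-tuple T,
        reduced_density mu rho lekn x
        = (((n - k)`!)%:R / (n`!)%:R
           * \det (\matrix_(i < k, j < k) K (tnth x i) (tnth x j)))%:E}.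

Definition independent d' (Om : measurableType d') (P : probability Om R) n
    (X : 'I_n -> {RV P >-> T}) : Prop :=
  forall (J : {set 'I_n}) (B : 'I_n -> set T),
    (forall i, measurable (B i)) ->
    P (\bigcap_(i in [set` J]) X i @^-1` B i)
    = (\prod_(i in J) P (X i @^-1` B i))%E.

Definition jittered d' (Om : measurableType d') (P : probability Om R)
    (mu : probability T R) n (A : 'I_n -> set T)
    (Y : 'I_n -> {RV P >-> T}) : Prop :=
  independent Y /\
  forall (i : 'I_n) (B : set T), measurable B ->
    P (Y i @^-1` B) = (n%:R%:E * mu (A i `&` B))%E.

(* Equality in law in the space of unordered n-tuples, the quotient of the
   n-tuples by permutations: its measurable sets are the permutation-invariant
   measurable sets of n-tuples. *)
Definition same_unordered_law
    d1 (Om1 : measurableType d1) (P1 : probability Om1 R)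
    d2 (Om2 : measurableType d2) (P2 : probability Om2 R) n
    (X : 'I_n -> {RV P1 >-> T}) (Y : 'I_n -> {RV P2 >-> T}) : Prop :=
  forall B : set (n.-tuple T), measurable B ->
    (forall (s : 'S_n) (x : n.-tuple T), B (permute s x) <-> B x) ->
    P1 [set w | B (joint X w)] = P2 [set w | B (joint Y w)].

Definition equipartitionable (mu : probability T R) : Prop :=
  forall n, (0 < n)%N -> exists B : 'I_n -> set T,
    [/\ forall i, measurable (B i), trivIset setT B,
        \bigcup_i B i = setT & forall i j, mu (B i) = mu (B j)].

Definition partition_kernel (mu : probability T R) n (A : 'I_n -> set T)
    (x y : T) : R :=
  \sum_(i < n) \1_(A i) x * \1_(A i) y / fine (mu (A i)).

End point_processes.

(* Main.v *)
Require Import Defs.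
From HB Require Import structures.
From mathcomp Require Import all_boot all_order all_algebra all_fingroup.
From mathcomp Require Import all_classical all_reals all_analysis.
From mathcomp Require Import measurable_realfun ring.

Set Implicit Arguments.
Unset Strict Implicit.
Unset Printing Implicit Defensive.
Import Order.TTheory GRing.Theory Num.Theory.

Local Open Scope classical_set_scope.
Local Open Scope ring_scope.

(**
  Since the cells are disjoint of mass [1/N], [det (K (x_i, x_j))] over [k] points
  equals [N^k] when the points lie in distinct cells, and [0] otherwise. On
  [N]-tuples this is the sum, over all permutations [s], of [N^N] times the
  indicator that [x_(s i)] lies in [A_i] for every [i]. Each summand is the
  density of a relabelled jittered sample, and the summands give equal mass to
  any permutation-invariant event.
*)

(** * Boxes and product measures on tuples *)

Section boxes.
Context d (T : measurableType d) (R : realType).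

Definition box n (B : 'I_n -> set T) : set (n.-tuple T) :=
  [set x | forall i, B i (tnth x i)].

Lemma measurable_box n (B : 'I_n -> set T) :
  (forall i, measurable (B i)) -> measurable (box B).
Proof.
move=> mB.
rewrite (_ : box B = \bigcap_(i in [set: 'I_n]) ((@tnth n T)^~ i @^-1` B i)).
  apply: fin_bigcap_measurable => // i _.
  by rewrite -[X in measurable X]setTI; exact: measurable_tnth.
by apply/seteqP; split => [x Bx i _|x Bx i]; apply: Bx.
Qed.

Lemma box_setI n (B C : 'I_n -> set T) :
  box B `&` box C = box (fun i => B i `&` C i).
Proof.
apply/seteqP; split => x; first by move=> [xB xC] i; split.
by move=> xBC; split => i; case: (xBC i).
Qed.

(** A constraint on a single coordinate is a box whose other sides are [setT], so boxes generate the
    coordinate sigma-algebra. Unlike single-coordinate constraints, they are stable under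
    intersection. *)
Lemma sigma_algebra_box n : @measurable _ (n.-tuple T) =
  <<s [set C | exists2 B : 'I_n -> set T, (forall i, measurable (B i)) & C = box B] >>.
Proof.
apply/seteqP; split.
  apply: smallest_sub; first exact: smallest_sigma_algebra.
  (* Naming a coordinate by [inord] requires a successor length; for length 0 the generating family
     is empty. *)
  case: n => [|n]; first by rewrite big_ord0.
  rewrite -bigcup_mkord_ord; apply: bigcup_sub => i Ii C [B mB <-].
  apply: sub_sigma_algebra.
  exists (fun j => if j == inord i then B else setT).
    by move=> j; case: ifP.
  rewrite setTI; apply/seteqP; split => x /=.
    by move=> Bx j; case: eqP => // ->.
  by move=> /(_ (inord i)); rewrite eqxx.
apply: smallest_sub; first exact: sigma_algebra_measurable.
by move=> C [B mB ->]; exact: measurable_box.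
Qed.

(** Boxes form a pi-system generating the sigma-algebra. The whole space is itself a box, so the
    constant sequence [setT] serves as exhaustion. *)
Lemma measure_eq_on_boxes n (m1 m2 : {measure set (n.-tuple T) -> \bar R}) :
  (m1 setT < +oo)%E ->
  (forall B : 'I_n -> set T, (forall i, measurable (B i)) ->
    m1 (box B) = m2 (box B)) ->
  forall C, measurable C -> m1 C = m2 C.
Proof.
move=> m1oo m12; apply: (measure_unique _ (fun=> setT) (@sigma_algebra_box n)).
- move=> _ _ [B mB ->] [C mC ->]; rewrite box_setI.
  by exists (fun i => B i `&` C i) => // i; exact: measurableI.
- by move=> _; exists (fun=> setT) => //; apply/seteqP; split.
- by rewrite bigcup_const //; exists 0%N.
- by move=> _ [B mB ->]; exact: m12.
- by [].
Qed.

(** Under [cons_pair], a box pulls back to the rectangle of its first side and the box of the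
    remaining sides. *)
Lemma mpower_box (mu : probability T R) n (B : 'I_n -> set T) :
  (forall i, measurable (B i)) ->
  mpower mu n (box B) = (\prod_(i < n) mu (B i))%E.
Proof.
elim: n B => [|n IHn] B mB.
  by rewrite big_ord0 /= diracE mem_set// => -[].
rewrite big_ord_recl -IHn; last by move=> i; exact: mB.
rewrite /= /distribution /pushforward -product_measure1E//; last first.
  by apply: measurable_box => i; exact: mB.
congr (_ _); apply/seteqP; split => -[t x] /=.
  move=> Bx; split; first by have := Bx ord0.
  by move=> i; have := Bx (lift ord0 i); rewrite tnthS.
move=> [Bt Bx] i; case: (unliftP ord0 i) => [j ->|->].
  by rewrite tnthS; exact: Bx.
by [].
Qed.

Lemma measurable_permute n (s : 'S_n) :
  measurable_fun setT (@permute d T n s).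
Proof.
apply/measurable_fun_tnthP => i.
rewrite (_ : _ \o _ = (@tnth n T)^~ (s i)); first exact: measurable_tnth.
by apply/funext => x /=; rewrite tnth_mktuple.
Qed.

Lemma measurable_permute_preimage n (s : 'S_n) (B : set (n.-tuple T)) :
  measurable B -> measurable (permute s @^-1` B).
Proof. by move=> mB; rewrite -[X in measurable X]setTI; exact: measurable_permute. Qed.

(** Permuting the sides of a box only reorders the product of their masses, and agreement on boxes
    suffices. *)
Lemma mpower_permute (mu : probability T R) n (s : 'S_n) (B : set (n.-tuple T)) :
  measurable B -> mpower mu n (permute s @^-1` B) = mpower mu n B.
Proof.
move=> mB.
pose ps : {mfun n.-tuple T >-> n.-tuple T} :=
  HB.pack (@permute d T n s) (isMeasurableFun.Build _ _ _ _ _ (@measurable_permute n s)).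
rewrite -[LHS]/(distribution (mpower mu n) ps B).
apply: measure_eq_on_boxes mB.
  by rewrite /= /distribution /pushforward preimage_setT probability_setT ltry.
move=> C mC.
(* Coordinate [i] of [permute s x] is coordinate [s i] of [x], so side [C i] constrains coordinate
   [s i]; hence the inverse. *)
transitivity (mpower mu n (box (fun i => C ((s^-1)%g i)))).
  congr (mpower mu n _); apply/seteqP; split => x xC i.
    by have := xC (s^-1%g i); rewrite /= tnth_mktuple permKV.
  by rewrite /= tnth_mktuple; have := xC (s i); rewrite /= permK.
rewrite -[RHS]/(mpower mu n (box C)) !mpower_box// (reindex_inj (@perm_inj _ s)) /=.
by apply: eq_bigr => i _; rewrite permK.
Qed.

Lemma integral_mpower_permute (mu : probability T R) n (s : 'S_n)
    (B : set (n.-tuple T)) (f : n.-tuple T -> \bar R) :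
  measurable B -> measurable_fun setT f -> (forall x, (0 <= f x)%E) ->
  (\int[mpower mu n]_(x in permute s @^-1` B) f (permute s x)
   = \int[mpower mu n]_(x in B) f x)%E.
Proof.
move=> mB mf f0.
rewrite -[LHS](ge0_integral_pushforward (@measurable_permute n s))//; last first.
  exact: measurable_funTS.
pose ps : {mfun n.-tuple T >-> n.-tuple T} :=
  HB.pack (@permute d T n s) (isMeasurableFun.Build _ _ _ _ _ (@measurable_permute n s)).
apply: (@eq_measure_integral _ _ _ _ _ (distribution (mpower mu n) ps)).
by move=> C mC _; exact: mpower_permute.
Qed.

Lemma integral_mpowerS (mu : probability T R) n (f : n.+1.-tuple T -> \bar R) :
  measurable_fun setT f -> (forall x, (0 <= f x)%E) ->
  (\int[mpower mu n.+1]_x f x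
   = \int[mu]_t \int[mpower mu n]_x f (cons_pair (t, x)))%E.
Proof.
move=> mf f0.
have mfc : measurable_fun setT (f \o @cons_pair _ T n).
  by apply: measurableT_comp => //; exact: measurable_cons_pair.
rewrite /= ge0_integral_pushforward// preimage_setT fubini_tonelli1// => x.
exact: f0.
Qed.

End boxes.

(** Provides the sample spaces in both existence claims. *)
Lemma probability_with_density d (T : measurableType d) (R : realType)
    (mu : probability T R) (f : T -> R) :
  measurable_fun setT f -> (forall x, 0 <= f x) ->
  (\int[mu]_x (f x)%:E = 1)%E ->
  exists P : probability T R, forall B, measurable B ->
    P B = (\int[mu]_(x in B) (f x)%:E)%E.
Proof.
move=> mf f0 f1.
pose P (B : set T) : \bar R := (\int[mu]_(x in B) (f x)%:E)%E.
have P0 : P set0 = 0%E by rewrite /P integral_set0.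
have P_ge0 B : (0 <= P B)%E by apply: integral_ge0 => x _; rewrite lee_fin.
have P_sigma : semi_sigma_additive P.
  move=> F mF tF mUF; rewrite /P ge0_integral_bigcup//.
  - by apply: is_cvg_nneseries => k _ _; exact: P_ge0.
  - by apply: measurable_funTS; exact/measurable_EFinP.
  - by move=> x _; rewrite lee_fin.
pose Pm : {measure set T -> \bar R} :=
  HB.pack P (isMeasure.Build _ _ _ P P0 P_ge0 P_sigma).
pose Pp : probability T R :=
  HB.pack P (Measure.on Pm) (Measure_isProbability.Build _ _ _ Pm f1).
by exists Pp.
Qed.

(** * Cells, the distinct-cells indicator and the kernel determinant *)

Section cells.
Context d (T : measurableType d) (R : realType) (N : nat) (A : 'I_N -> set T).
Hypothesis disjA : forall i j, i != j -> A i `&` A j = set0.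

(** The cells cover the space only up to a null set; [None] marks a point outside all of them. *)
Definition cell (x : T) : option 'I_N := [pick a | x \in A a].

Lemma cell_eq a x : (cell x == Some a) = (x \in A a).
Proof.
rewrite /cell; case: pickP => [b xb|nx]; last by rewrite nx; apply/eqP.
apply/eqP/idP => [[<-]//|xa]; congr Some; apply/eqP/negPn/negP => ba.
have : (A b `&` A a) x by split; exact: set_mem.
by rewrite disjA.
Qed.

(** The indicator that the points lie in pairwise distinct cells with indices in [S]. Deleting each
    used cell from [S] makes it possible to integrate one coordinate at a time. *)
Fixpoint distinct_cells (S : {set 'I_N}) (s : seq T) : R :=
  if s is x :: s' then \sum_(a in S) \1_(A a) x * distinct_cells (S :\ a) s'
  else 1.

(** At most one term of the sum survives, that of the cell of the head. Deleting this cell from [S]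
    forbids it to all later points. *)
Lemma distinct_cellsE S s : distinct_cells S s =
  (uniq (map cell s) &&
   all (fun x => if cell x is Some a then a \in S else false) s)%:R.
Proof.
elim: s S => //= x s IHs S.
under eq_bigr => a _ do rewrite IHs indicE -cell_eq.
case cx : (cell x) => [b|] /=; last first.
  by rewrite andbF big1// => a _; rewrite mul0r.
have [bS|bS] := boolP (b \in S); last first.
  rewrite andbF big1// => a aS; case: eqP => [[ba]|]; last by rewrite mul0r.
  by rewrite ba aS in bS.
rewrite (bigD1 b)//= big1 ?addr0 => [|a /andP[_ ab]]; last first.
  by rewrite (_ : _ == _ = false) ?mul0r//; apply: contraNF ab => /eqP[->].
rewrite eqxx mul1r; congr (nat_of_bool _)%:R.
rewrite [RHS]andbAC [RHS]andbC; congr (_ && _).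
(* That [Some b] is not among the later cells becomes a condition on each later point, which merges
   with membership in [S] into membership in [S :\ b]. *)
rewrite -[Some b \notin _]/(~~ (_ \in _)) -has_pred1 -all_predC all_map -all_predI.
apply: eq_all => y /=; case: (cell y) => [a|]; last by rewrite andbF.
by rewrite in_setD1 -[_ == Some b]/(a == b).
Qed.

Lemma distinct_cells_permute (s : 'S_N) (x : N.-tuple T) S :
  distinct_cells S (permute s x) = distinct_cells S x.
Proof.
have px : perm_eq (permute s x) x by apply/tuple_permP; exists s.
by rewrite !distinct_cellsE (perm_uniq (perm_map _ px)) (perm_all _ px).
Qed.

(** Equal points share a cell or lie in none. This yields simplicity of the process. *)
Lemma distinct_cells_eq0 n S (x : n.-tuple T) i j :
  i != j -> tnth x i = tnth x j -> distinct_cells S x = 0.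
Proof.
move=> ij xij; rewrite distinct_cellsE (_ : uniq _ = false)//.
apply: contraNF ij => /(tuple_uniqP (map_tuple cell x)) inj_x; apply/eqP/inj_x.
by rewrite !tnth_map xij.
Qed.

(* If the cells of [x] are distinct, they form a permutation of ['I_N], and its
   inverse is the only [s] contributing to the sum. *)
Lemma distinct_cells_sum_permute (x : N.-tuple T) :
  distinct_cells [set: 'I_N]%SET x = \sum_(s : 'S_N) \1_(box A) (permute s x).
Proof.
have boxE s : (permute s x \in box A) =
    [forall i, cell (tnth x (s i)) == Some i].
  apply/idP/forallP => [/set_mem xs i|xs].
    by rewrite cell_eq; apply/mem_set; have := xs i; rewrite tnth_mktuple.
  apply/mem_set => i; rewrite tnth_mktuple; apply/set_mem.
  by rewrite -cell_eq.
under eq_bigr => s _ do rewrite indicE boxE.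
rewrite distinct_cellsE; case: (boolP (_ && _)) => [/andP[ux ax]|nux].
  have cx i : {a | cell (tnth x i) = Some a}.
    have /allP/(_ _ (mem_tnth i x)) := ax.
    by case: (cell _) => // a _; exists a.
  pose p i := sval (cx i).
  have pE i : cell (tnth x i) = Some (p i) by rewrite /p; case: (cx i).
  have p_inj : injective p.
    move=> i j pij; have /tuple_uniqP := ux : uniq (map_tuple cell x).
    by apply; rewrite !tnth_map !pE pij.
  rewrite (bigD1 (perm p_inj)^-1%g)//= big1 ?addr0 => [|s ns].
    rewrite (_ : [forall i, _])//; apply/forallP => i.
    by rewrite pE -(permE p_inj) permKV.
  rewrite (_ : [forall i, _] = false)//.
  apply: contraNF ns => /forallP xs; apply/eqP/permP => i.
  apply: (@perm_inj _ (perm p_inj)); rewrite permKV permE.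
  by apply: Some_inj; rewrite -pE; exact/eqP.
rewrite big1// => s _; rewrite (_ : [forall i, _] = false)//.
apply: contraNF nux => /forallP xs.
have cx i : cell (tnth x i) = Some (s^-1%g i).
  by have /eqP := xs (s^-1%g i); rewrite permKV.
apply/andP; split.
  apply/(tuple_uniqP (map_tuple cell x)) => i j; rewrite !tnth_map !cx => -[].
  exact: perm_inj.
by apply/all_tnthP => i; rewrite cx inE.
Qed.

(** A point in no cell gives a zero row, and two points in one cell give equal rows. In the
    remaining case the matrix is [c] times the identity. *)
Lemma det_distinct_cells n (c : R) (x : n.-tuple T) :
  \det (\matrix_(i < n, j < n)
    (c * ((cell (tnth x i) == cell (tnth x j)) && (cell (tnth x i) != None))%:R))
  = c ^+ n * distinct_cells [set: 'I_N]%SET x.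
Proof.
rewrite distinct_cellsE.
have -> : all (fun y => if cell y is Some a then a \in [set: 'I_N]%SET else false) x
    = all (fun y => cell y != None) x.
  by apply: eq_all => y; case: (cell y) => // a; rewrite inE.
have [/all_tnthP cx|/allPn[y /tnthP[i ->] cx]] := boolP (all _ x); last first.
  rewrite andbF mulr0 (expand_det_row _ i) big1// => j _.
  by rewrite mxE (negPf cx) andbF mulr0 mul0r.
have [/(tuple_uniqP (map_tuple cell x)) ux|ux] := boolP (uniq _).
  rewrite mulr1 -det_scalar; congr (\det _); apply/matrixP => i j.
  rewrite !mxE cx andbT mulr_natr; congr (_ *+ nat_of_bool _).
  by rewrite -(inj_eq ux) !tnth_map.
rewrite mulr0.
have /injectivePn[i [j ij cij]] : ~~ injectiveb (tnth (map_tuple cell x)).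
  by apply: contra ux => /injectiveP/tuple_uniqP.
apply: (determinant_alternate ij) => k; rewrite !mxE.
by move: cij; rewrite !tnth_map => ->.
Qed.

(** By disjointness only the common cell of [x] and [y] can contribute, with weight [N], the inverse
    of its mass. *)
Lemma partition_kernelE (mu : probability T R) x y :
  (forall i, mu (A i) = (N%:R^-1)%:E) ->
  partition_kernel mu A x y =
  N%:R * ((cell x == cell y) && (cell x != None))%:R.
Proof.
move=> muA; rewrite /partition_kernel.
under eq_bigr => i _ do rewrite muA /= invrK !indicE -!cell_eq.
case cx : (cell x) => [a|]; last first.
  by rewrite andbF mulr0 big1// => i _; rewrite !mul0r.
rewrite andbT (bigD1 a)//= big1 ?addr0 => [|i ia].
  by rewrite eqxx mul1r mulrC eq_sym.
by rewrite (_ : _ == _ = false) ?mul0r//; apply: contraNF ia => /eqP[->].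
Qed.

End cells.

(** * Integrals of the distinct-cells indicator *)

Section distinct_cells_integral.
Context d (T : measurableType d) (R : realType) (mu : probability T R).
Context (N : nat) (A : 'I_N -> set T).
Hypothesis mA : forall i, measurable (A i).
Hypothesis muA : forall i, mu (A i) = (N%:R^-1)%:E.

Local Notation D := (@distinct_cells d T R N A).

Lemma distinct_cells_ge0 S s : 0 <= D S s.
Proof.
elim: s S => //= x s IHs S.
by apply: sumr_ge0 => a _; rewrite mulr_ge0// indicE.
Qed.

Lemma measurable_distinct_cells n S :
  measurable_fun setT (fun x : n.-tuple T => D S x).
Proof.
elim: n S => [|n IHn] S.
  rewrite (_ : (fun _ => _) = cst 1); first exact: measurable_cst.
  by apply/funext => x; rewrite tuple0.
(* The sum is taken over the list [enum S] to fit [measurable_sum], and the tuple is split into head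
   and tail. *)
rewrite (_ : (fun _ => _) = fun x : n.+1.-tuple T =>
    \sum_(a <- enum S) \1_(A a) (tnth x ord0) * D (S :\ a) [tuple of behead x]).
  apply: measurable_sum => a; apply: measurable_funM.
    exact: measurableT_comp (measurable_indic (mA a)) (measurable_tnth ord0).
  exact: measurableT_comp (IHn _) (@measurable_behead _ T n).
by apply/funext => x; rewrite big_enum [in LHS](tuple_eta x).
Qed.

Lemma measurable_distinct_cells_cat n S s :
  measurable_fun setT (fun y : n.-tuple T => D S (s ++ y)).
Proof.
elim: s S => [|x s IHs] S; first exact: measurable_distinct_cells.
rewrite (_ : (fun _ => _) = fun y : n.-tuple T =>
    \sum_(a <- enum S) \1_(A a) x * D (S :\ a) (s ++ y)).
  by apply: measurable_sum => a; apply: measurable_funM => //; exact: IHs.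
by apply/funext => y; rewrite big_enum.
Qed.

Lemma card_setD1_in (S : {set 'I_N}) a : a \in S -> #|S :\ a| = #|S|.-1.
Proof. by move=> aS; rewrite (cardsD1 a S) aS. Qed.

(** The first point has [#|S|] cells to choose from, the next one fewer, and so on, which gives the
    falling factorial; each choice has mass [1/N]. *)
Lemma integral_distinct_cells m (S : {set 'I_N}) :
  (\int[mpower mu m]_y (D S y)%:E = ((#|S| ^_ m)%:R / N%:R ^+ m)%:E)%E.
Proof.
elim: m S => [|m IHm] S.
  rewrite (_ : (fun _ => _) = cst 1%E); last first.
    by apply/funext => y; rewrite tuple0.
  by rewrite integral_cst//= diracT mule1 ffactn0 expr0 divr1.
rewrite integral_mpowerS; last 2 first.
- by apply/measurable_EFinP; exact: measurable_distinct_cells.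
- by move=> y; rewrite lee_fin distinct_cells_ge0.
(* The integral over the later points, the same for every cell [a] of the first point, since only
   the size of [S :\ a] matters. *)
pose c : R := (#|S|.-1 ^_ m)%:R / N%:R ^+ m.
have c0 : (0 <= c%:E)%E by rewrite lee_fin divr_ge0.
have inner t : (\int[mpower mu m]_x (D S (cons_pair (t, x)))%:E
    = \sum_(a <- enum S) (\1_(A a) t)%:E * c%:E)%E.
  under eq_integral => x _ do rewrite /= -big_enum -sumEFin.
  rewrite ge0_integral_sum//; last 2 first.
  - move=> a; apply/measurable_EFinP/measurable_funM => //.
    exact: measurable_distinct_cells.
  - by move=> a x _; rewrite lee_fin mulr_ge0 ?distinct_cells_ge0// indicE.
  apply: eq_big_seq => a; rewrite mem_enum => aS.
  under eq_integral => x _ do rewrite EFinM.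
  rewrite ge0_integralZl//; last 2 first.
  - by apply/measurable_EFinP; exact: measurable_distinct_cells.
  - by move=> x _; rewrite lee_fin distinct_cells_ge0.
  by rewrite IHm card_setD1_in.
under eq_integral => t _ do rewrite inner.
rewrite ge0_integral_sum//; last 2 first.
- move=> a; apply: emeasurable_funM => //.
  by apply/measurable_EFinP; exact: measurable_indic.
- by move=> a x _; rewrite mule_ge0// lee_fin indicE.
rewrite (eq_bigr (fun=> (N%:R^-1 * c)%:E)) => [|a _].
  rewrite sumEFin big_enum sumr_const -[_ *+ #|S|]mulr_natl ffactnS exprS.
  by rewrite invfM natrM /c; congr (_%:E); ring.
rewrite ge0_integralZr//; last first.
  by apply/measurable_EFinP; exact: measurable_indic.
by rewrite integral_indic// setIT [RHS]EFinM; congr (_ * c%:E)%E; exact: muA.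
Qed.

(** When the points of [s] are in distinct cells of [S], they use up [size s] of them and the other
    points choose among the rest; otherwise both sides vanish. The latter covers the case where the
    subtraction truncates. *)
Lemma integral_distinct_cells_cat m (S : {set 'I_N}) (s : seq T) :
  (\int[mpower mu m]_y (D S (s ++ y))%:E
   = (D S s * (((#|S| - size s) ^_ m)%:R / N%:R ^+ m))%:E)%E.
Proof.
elim: s S => [|x s IHs] S; first by rewrite integral_distinct_cells mul1r subn0.
under eq_integral => y _ do rewrite /= -big_enum -sumEFin.
rewrite ge0_integral_sum//; last 2 first.
- move=> a; apply/measurable_EFinP/measurable_funM => //.
  exact: measurable_distinct_cells_cat.
- by move=> a y _; rewrite lee_fin mulr_ge0 ?distinct_cells_ge0// indicE.
rewrite /= mulr_suml -sumEFin -[RHS]big_enum; apply: eq_big_seq => a.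
rewrite mem_enum => aS.
under eq_integral => y _ do rewrite EFinM.
rewrite ge0_integralZl//; last 2 first.
- by apply/measurable_EFinP; exact: measurable_distinct_cells_cat.
- by move=> y _; rewrite lee_fin distinct_cells_ge0.
by rewrite IHs card_setD1_in// -subn1 -subnDA add1n -EFinM mulrA.
Qed.

End distinct_cells_integral.

(** * Full reduced density and coordinate processes *)

Section processes.
Context d (T : measurableType d) (R : realType) (mu : probability T R).

(** No variable is integrated out. This recovers the density itself from the determinantal identity
    for [k = N]. *)
Lemma reduced_density_full n (rho : n.-tuple T -> R) (lenn : (n <= n)%N) x :
  reduced_density mu rho lenn x = (rho x)%:E.
Proof.
rewrite /reduced_density; move: (subnKC lenn).
(* The type of the cast depends on [n - n], so this number is generalized before it is replaced by
   0. *)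
move: (n - n)%N (subnn n) => m m0; subst m => e.
rewrite (_ : (fun _ => _) = cst (rho x)%:E); last first.
  apply/funext => y; congr (rho _)%:E.
  by apply: val_inj; rewrite /= val_tcast /= tuple0 cats0.
by rewrite integral_cst//= diracT mule1.
Qed.

Lemma measurable_joint d' (Om : measurableType d') (P : probability Om R) n
  (X : 'I_n -> {RV P >-> T}) : measurable_fun setT (joint X).
Proof.
apply/measurable_fun_tnthP => i.
rewrite (_ : _ \o _ = X i); first exact: measurable_funPT.
by apply/funext => w /=; rewrite tnth_mktuple.
Qed.

Lemma coordinate_process n (P : probability (n.-tuple T) R) :
  exists X : 'I_n -> {RV P >-> T}, forall w, joint X w = w.
Proof.
pose X (i : 'I_n) : {RV P >-> T} :=
  HB.pack (fun x : n.-tuple T => tnth x i)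
    (isMeasurableFun.Build _ _ _ _ _ (@measurable_tnth _ T n i)).
by exists X => w; apply: eq_from_tnth => i; rewrite tnth_mktuple.
Qed.

(** * The density of the determinantal process *)

Context (N : nat) (A : 'I_N -> set T).
Hypothesis N_gt0 : (0 < N)%N.
Hypothesis mA : forall i, measurable (A i).
Hypothesis disjA : forall i j, i != j -> A i `&` A j = set0.
Hypothesis muA : forall i, mu (A i) = (N%:R^-1)%:E.

Local Notation D := (@distinct_cells d T R N A [set: 'I_N]%SET).

(** The determinant of the kernel matrix at [N] points, divided by [N!]. *)
Definition dpp_density (x : N.-tuple T) : R := N%:R ^+ N / N`!%:R * D x.

Lemma dpp_density_ge0 x : 0 <= dpp_density x.
Proof. by rewrite mulr_ge0 ?divr_ge0 ?exprn_ge0 ?distinct_cells_ge0. Qed.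

Lemma measurable_dpp_density : measurable_fun setT dpp_density.
Proof. by apply: measurable_funM => //; exact: measurable_distinct_cells. Qed.

(** Once [k] points occupy distinct cells, integrating out the others gives [(N-k)!/N^(N-k)]. This
    turns [N^N/N!] into [N^k (N-k)!/N!], and [N^k] is the determinant. *)
Lemma reduced_dpp_density k (lekN : (k <= N)%N) (x : k.-tuple T) :
  reduced_density mu dpp_density lekN x
  = (((N - k)`!)%:R / (N`!)%:R * \det (\matrix_(i < k, j < k)
       partition_kernel mu A (tnth x i) (tnth x j)))%:E.
Proof.
have N0 : N%:R != 0 :> R by rewrite pnatr_eq0 -lt0n.
have -> : \det (\matrix_(i < k, j < k)
    partition_kernel mu A (tnth x i) (tnth x j)) = N%:R ^+ k * D x.
  rewrite -det_distinct_cells//; congr (\det _).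
  by apply/matrixP => i j; rewrite !mxE partition_kernelE.
rewrite /reduced_density /dpp_density.
under eq_integral => y _ do rewrite val_tcast /= EFinM.
rewrite ge0_integralZl//; last 2 first.
- by apply/measurable_EFinP; exact: measurable_distinct_cells_cat.
- by move=> y _; rewrite lee_fin distinct_cells_ge0.
rewrite integral_distinct_cells_cat// cardsT card_ord size_tuple ffactnn -EFinM.
have -> : N%:R ^+ N = N%:R ^+ k * N%:R ^+ (N - k) :> R.
  by rewrite -exprD subnKC.
by congr (_%:E); field; rewrite expf_neq0// pnatr_eq0 -lt0n fact_gt0.
Qed.

Lemma integral_dpp_density : (\int[mpower mu N]_x (dpp_density x)%:E = 1)%E.
Proof.
have N0 : N%:R != 0 :> R by rewrite pnatr_eq0 -lt0n.
rewrite /dpp_density; under eq_integral => x _ do rewrite EFinM.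
rewrite ge0_integralZl//; last 2 first.
- by apply/measurable_EFinP; exact: measurable_distinct_cells.
- by move=> y _; rewrite lee_fin distinct_cells_ge0.
rewrite integral_distinct_cells// cardsT card_ord ffactnn -EFinM.
by congr (_%:E); field; rewrite expf_neq0// pnatr_eq0 -lt0n fact_gt0.
Qed.

(** By invariance of [B], a change of variables gives all [N!] summands of the indicator the same
    integral, and their number cancels the [1/N!] of the density. *)
Lemma integral_dpp_density_symmetric (B : set (N.-tuple T)) :
  measurable B -> (forall (s : 'S_N) x, B (permute s x) <-> B x) ->
  (\int[mpower mu N]_(x in B) (dpp_density x)%:E
   = (N%:R ^+ N)%:E * mpower mu N (box A `&` B))%E.
Proof.
move=> mB symB; have mbA := measurable_box mA.
have term (s : 'S_N) : (\int[mpower mu N]_(x in B) (\1_(box A) (permute s x))%:E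
    = mpower mu N (box A `&` B))%E.
  have {1}-> : B = permute s @^-1` B.
    by apply/seteqP; split => x Bx; apply/(symB s x).
  rewrite (integral_mpower_permute _ _ (f := EFin \o \1_(box A)))//=.
    by rewrite integral_indic.
  by apply/measurable_EFinP; exact: measurable_indic.
rewrite /dpp_density; under eq_integral => x _ do rewrite EFinM.
rewrite ge0_integralZl//; last 2 first.
- apply: measurable_funTS; apply/measurable_EFinP.
  exact: measurable_distinct_cells.
- by move=> y _; rewrite lee_fin distinct_cells_ge0.
under eq_integral => x _ do
  rewrite distinct_cells_sum_permute// -sumEFin.
rewrite ge0_integral_sum//; last first.
  move=> s; apply: measurable_funTS; apply/measurable_EFinP.
  exact: measurableT_comp (measurable_indic mbA) (measurable_permute s).
under eq_bigr => s _ do rewrite term.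
rewrite -[mpower mu N _]fineK; last exact: fin_num_measure (measurableI _ _ mbA mB).
rewrite sumEFin sumr_const card_Sn -!EFinM.
congr (_%:E); rewrite -[fine _ *+ _]mulr_natr; field.
by rewrite pnatr_eq0 -lt0n fact_gt0.
Qed.

Lemma exists_determinantal : exists P : probability (N.-tuple T) R,
  exists X : 'I_N -> {RV P >-> T}, determinantal mu (partition_kernel mu A) X.
Proof.
have [P PE] := probability_with_density measurable_dpp_density
  dpp_density_ge0 integral_dpp_density.
have [X XE] := coordinate_process P; exists P, X.
have mD := @measurable_distinct_cells _ T R _ A mA N [set: 'I_N]%SET.
split.
  (* Coincidences are enclosed in the measurable set where the density vanishes. *)
  exists [set x : N.-tuple T | D x = 0]; split.
  - rewrite -[X in measurable X]setTI.
    exact: mD measurableT [set 0] (measurable_set1 0).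
  - rewrite PE; last first.
      rewrite -[X in measurable X]setTI.
      exact: mD measurableT [set 0] (measurable_set1 0).
    apply: integral0_eq => x /= Dx.
    by rewrite /dpp_density Dx mulr0.
  move=> w [i [j [ij Xij]]] /=; apply: (distinct_cells_eq0 R disjA _ ij).
  by rewrite -(XE w) !tnth_mktuple.
exists dpp_density; last by move=> k lekN _; apply: aeW => x; exact: reduced_dpp_density.
have rho_sym (s : 'S_N) x : dpp_density (permute s x) = dpp_density x.
  by rewrite /dpp_density distinct_cells_permute.
have joint_id (B : set (N.-tuple T)) : [set w | B (joint X w)] = B.
  by apply/seteqP; split => w /=; rewrite XE.
split => //.
  move=> s B mB; rewrite (joint_id (permute s @^-1` B)) joint_id.
  rewrite !PE//; last exact: measurable_permute_preimage.
  under eq_integral => x _ do rewrite -(rho_sym s).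
  apply: (integral_mpower_permute _ _ (f := EFin \o dpp_density)) => //.
    by apply/measurable_EFinP; exact: measurable_dpp_density.
  by move=> x; rewrite lee_fin dpp_density_ge0.
split; [exact: measurable_dpp_density | exact: dpp_density_ge0 | ].
by move=> B mB; rewrite joint_id PE.
Qed.

(** * The jittered process, and the laws of both processes *)

Lemma mpower_boxI (B : 'I_N -> set T) : (forall i, measurable (B i)) ->
  ((N%:R ^+ N)%:E * mpower mu N (box A `&` box B)
   = \prod_(i < N) (N%:R%:E * mu (A i `&` B i)))%E.
Proof.
move=> mB; rewrite box_setI mpower_box; last by move=> i; exact: measurableI.
by rewrite big_split /= prodEFin prodr_const card_ord.
Qed.

Lemma cell_mass i : (N%:R%:E * mu (A i) = 1)%E.
Proof. by rewrite muA -EFinM mulfV// pnatr_eq0 -lt0n. Qed.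

(** The density [f] is the product over [i] of the densities [N] times the indicator of [A i], so
    the coordinates are independent with the prescribed laws. *)
Lemma exists_jittered : exists P : probability (N.-tuple T) R,
  exists Y : 'I_N -> {RV P >-> T}, jittered mu A Y.
Proof.
have mbA := measurable_box mA.
pose f (x : N.-tuple T) : R := N%:R ^+ N * \1_(box A) x.
have int_f (B : set (N.-tuple T)) : measurable B ->
    (\int[mpower mu N]_(x in B) (f x)%:E
     = (N%:R ^+ N)%:E * mpower mu N (box A `&` B))%E.
  move=> mB; rewrite /f; under eq_integral => x _ do rewrite EFinM.
  rewrite ge0_integralZl//; last by apply/measurable_EFinP; exact: measurable_indic.
  by rewrite integral_indic.
have int_box (B : 'I_N -> set T) : (forall i, measurable (B i)) ->
    (\int[mpower mu N]_(x in box B) (f x)%:E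
     = \prod_(i < N) (N%:R%:E * mu (A i `&` B i)))%E.
  by move=> mB; rewrite int_f ?mpower_boxI//; exact: measurable_box.
have f1 : (\int[mpower mu N]_x (f x)%:E = 1)%E.
  rewrite (_ : setT = box (fun=> setT)); last by apply/seteqP; split.
  by rewrite int_box// big1// => i _; rewrite setIT cell_mass.
have [||P PE] := probability_with_density (f := f) _ _ f1.
- by apply: measurable_funM => //; exact: measurable_indic.
- by move=> x; rewrite mulr_ge0// indicE.
have [Y YE] := coordinate_process P; exists P, Y.
have Ytnth i w : Y i w = tnth w i by rewrite -{2}(YE w) tnth_mktuple.
have margin i B : measurable B -> P (Y i @^-1` B) = (N%:R%:E * mu (A i `&` B))%E.
  move=> mB.
  (* A marginal event is a box with a single proper side; every other factor is [N] times the mass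
     of a cell, which is 1. *)
  rewrite (_ : Y i @^-1` B = box (fun j => if j == i then B else setT)); last first.
    apply/seteqP; split => w /=.
      by rewrite Ytnth => Bw j; case: eqP => // ->.
    by move=> /(_ i); rewrite eqxx Ytnth.
  have mB' j : measurable (if j == i then B else setT) by case: ifP.
  rewrite PE; last exact: measurable_box.
  rewrite int_box// (bigD1 i)//= big1 ?mule1 ?eqxx// => j /negPf ->.
  by rewrite setIT cell_mass.
split => // J B mB.
rewrite (_ : \bigcap_(i in _) _ = box (fun i => if i \in J then B i else setT)); last first.
  apply/seteqP; split => w wB i.
    by case: ifP => // iJ; rewrite -Ytnth; exact: wB.
  by move=> /= iJ; have := wB i; rewrite iJ Ytnth.
have mB' i : measurable (if i \in J then B i else setT) by case: ifP.
rewrite PE; last exact: measurable_box.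
rewrite int_box// [RHS]big_mkcond; apply: eq_bigr => i _.
by case: ifP => _; [rewrite margin | rewrite setIT cell_mass].
Qed.

(** Independence over the full index set fixes the law on boxes, hence everywhere. *)
Lemma jittered_law d' (Om : measurableType d') (P : probability Om R)
    (Y : 'I_N -> {RV P >-> T}) (B : set (N.-tuple T)) :
  jittered mu A Y -> measurable B ->
  P [set w | B (joint Y w)] = ((N%:R ^+ N)%:E * mpower mu N (box A `&` B))%E.
Proof.
move=> [indepY margY] mB; have mbA := measurable_box mA.
have cN : 0 <= N%:R ^+ N :> R by rewrite exprn_ge0.
pose Y' : {mfun Om >-> N.-tuple T} :=
  HB.pack (joint Y) (isMeasurableFun.Build _ _ _ _ _ (measurable_joint Y)).
(* The right-hand side is presented as a measure in [B], so that uniqueness on boxes applies. *)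
transitivity (mscale (NngNum cN) (mrestr (mpower mu N) mbA) B); last first.
  by rewrite /mscale /= /mrestr setIC.
rewrite -[LHS]/(distribution P Y' B).
apply: measure_eq_on_boxes mB.
  by rewrite /= /distribution /pushforward preimage_setT probability_setT ltry.
move=> C mC; rewrite /= /mscale /= /mrestr setIC mpower_boxI//.
rewrite /distribution /pushforward.
rewrite (_ : _ @^-1` _ = \bigcap_(i in [set` [set: 'I_N]%SET]) Y i @^-1` C i).
  rewrite indepY//; apply: eq_big => [i|i _]; first by rewrite inE.
  by rewrite margY.
apply/seteqP; split => w wC i.
  by move=> _; have := wC i; rewrite tnth_mktuple.
by rewrite tnth_mktuple; apply: wC; rewrite /= inE.
Qed.

(** For [k = N] the determinantal identity says that any admissible density equals [dpp_density]
    almost everywhere, so the kernel determines the law. *)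
Lemma determinantal_law d' (Om : measurableType d') (P : probability Om R)
    (X : 'I_N -> {RV P >-> T}) (B : set (N.-tuple T)) :
  determinantal mu (partition_kernel mu A) X -> measurable B ->
  P [set w | B (joint X w)] = (\int[mpower mu N]_(x in B) (dpp_density x)%:E)%E.
Proof.
move=> [_ [rho [_ [mrho rho0 PE] _] rhoE]] mB; rewrite PE//.
apply: ge0_ae_eq_integral => //.
- by apply: measurable_funTS; apply/measurable_EFinP.
- apply: measurable_funTS; apply/measurable_EFinP.
  exact: measurable_dpp_density.
- by move=> x _; rewrite lee_fin.
- by move=> x _; rewrite lee_fin dpp_density_ge0.
apply: filterS (rhoE N (leqnn N) N_gt0) => x + _.
by rewrite -reduced_dpp_density !reduced_density_full.
Qed.

End processes.

(** * Existence of both processes and equality of their unordered laws *)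

Theorem mainTheorem4 (R : realType) (d : measure_display)
    (T : measurableType d) (mu : probability T R)
    (hmu : equipartitionable mu)
    (N : nat) (hN : (0 < N)%N) (A : 'I_N -> set T)
    (mA : forall i, measurable (A i))
    (disjA : forall i j, i != j -> A i `&` A j = set0)
    (covA : mu (\bigcup_i A i) = 1%E)
    (muA : forall i, mu (A i) = (N%:R^-1)%:E) :
  [/\ exists (d1 : measure_display) (Om1 : measurableType d1)
        (P1 : probability Om1 R) (X : 'I_N -> {RV P1 >-> T}),
        determinantal mu (partition_kernel mu A) X,
      exists (d2 : measure_display) (Om2 : measurableType d2)
        (P2 : probability Om2 R) (Y : 'I_N -> {RV P2 >-> T}),
        jittered mu A Y &
      forall (d1 : measure_display) (Om1 : measurableType d1)
        (P1 : probability Om1 R) (X : 'I_N -> {RV P1 >-> T})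
        (d2 : measure_display) (Om2 : measurableType d2)
        (P2 : probability Om2 R) (Y : 'I_N -> {RV P2 >-> T}),
        determinantal mu (partition_kernel mu A) X ->
        jittered mu A Y ->
        same_unordered_law X Y].
Proof.
split.
- have [P [X detX]] := exists_determinantal hN mA disjA muA.
  by do 3 eexists; exists X.
- have [P [Y jitY]] := exists_jittered hN mA muA.
  by do 3 eexists; exists Y.
move=> d1 Om1 P1 X d2 Om2 P2 Y detX jitY B mB symB.
rewrite (determinantal_law hN mA disjA muA detX mB) (jittered_law mA jitY mB).
exact: integral_dpp_density_symmetric.
Qed.
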